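(* Let $q$ be a prime power and $A\subseteq\mathbb{F}_q$ with $0\notin A$ and $|A|>q^{2/3}$. Then there exists $a\in A$ such that \[ |A(a+A)|>\frac q2, \] where $A(a+A)=\{b(a+c): b,c\in A\}$. *)

(* Defs.v *)
From HB Require Import structures.
From mathcomp Require Import all_boot all_order all_algebra.

Set Implicit Arguments.
Unset Strict Implicit.
Unset Printing Implicit Defensive.

Import GRing.Theory.
Local Open Scope ring_scope.

Definition mul_shift_set (F : finFieldType) (a : F) (A : {set F}) : {set F} :=
  [set b * (a + c) | b in A, c in A].

(* Main.v *)
(** For [a] in [F] let [E a] be the number of pairs of points of [A x A] on
    which [(b, c) |-> b * (a + c)] agrees.  Cauchy-Schwarz gives
    [#|A|^4 <= #|A(a + A)| * E a], hence [#|A|^4 <= q * E a] for every [a], and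
    [2 * #|A|^4 <= q * E a] if [2 * #|A(a + A)| <= q].  Two distinct points agree
    for at most one [a], so the sum of [E a] over the whole field is at most
    [#|A|^4 + q * #|A|^2].  If every [a] in [A] failed, comparing the two
    bounds would give [#|A|^5 <= q^2 * #|A|^2]. *)
Require Import Defs.
From HB Require Import structures.
From mathcomp Require Import all_boot all_order all_algebra.
From mathcomp Require Import reals exp.
From mathcomp Require Import ring.

Set Implicit Arguments.
Unset Strict Implicit.
Unset Printing Implicit Defensive.

Import Order.TTheory GRing.Theory Num.Theory.
Local Open Scope ring_scope.

(** After doubling, both sides are sums over pairs [(i, j)], compared termwise by
    [2xy <= x^2 + y^2]. *)
Lemma leq_sqr_sum (I : finType) (P : {pred I}) (f : I -> nat) :
  ((\sum_(i in P) f i) ^ 2 <= #|P| * \sum_(i in P) f i ^ 2)%N.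
Proof.
rewrite -(leq_pmul2l (isT : 0 < 2)%N).
have -> : (2 * (#|P| * \sum_(i in P) f i ^ 2) =
    \sum_(i in P) \sum_(j in P) (f i ^ 2 + f j ^ 2))%N.
  under [RHS]eq_bigr => i _ do rewrite big_split sum_nat_const.
  by rewrite big_split sum_nat_const -big_distrr mul2n -addnn.
rewrite -mulnn big_distrlr big_distrr leq_sum // => i _.
by rewrite big_distrr leq_sum // => j _; exact: nat_Cauchy.
Qed.

(** Cauchy-Schwarz over the fibres of [phi]: their sizes [f x] sum to [#|P|], and the squares of the
    sizes sum to the number of colliding pairs. *)
Lemma leq_card_collision (T U : finType) (P : {set T}) (phi : T -> U) :
  (#|P| ^ 2 <=
   #|phi @: P| * \sum_(p in P) \sum_(p' in P) (phi p == phi p'))%N.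
Proof.
pose f x := (\sum_(p in P) (phi p == x))%N.
have -> : #|P| = (\sum_(x in phi @: P) f x)%N.
  rewrite exchange_big -sum1_card; apply: eq_bigr => p Pp.
  rewrite (bigD1 (phi p)) ?imset_f //= eqxx big1 ?addn0 // => x /andP[_].
  by rewrite eq_sym => /negPf ->.
have -> : (\sum_(p in P) \sum_(p' in P) (phi p == phi p') =
           \sum_(x in phi @: P) f x ^ 2)%N.
  under [RHS]eq_bigr => x _ do rewrite -mulnn {1}/f big_distrl.
  rewrite [RHS]exchange_big; apply: eq_bigr => p Pp.
  rewrite [RHS](bigD1 (phi p)) ?imset_f //= eqxx mul1n [X in (_ + X)%N]big1 => [|x /andP[_]].
    by rewrite addn0; apply: eq_bigr => p' _; rewrite eq_sym.
  by rewrite eq_sym => /negPf ->.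
exact: leq_sqr_sum.
Qed.

Section ShiftedProduct.

Variable F : finFieldType.

Definition shift_prod (a : F) (p : F * F) : F := p.1 * (a + p.2).

Definition shift_energy (A : {set F}) (a : F) : nat :=
  (\sum_(p in setX A A) \sum_(p' in setX A A)
     (shift_prod a p == shift_prod a p'))%N.

Lemma mul_shift_setE (a : F) (A : {set F}) :
  mul_shift_set a A = shift_prod a @: setX A A.
Proof.
apply/setP => x; apply/imset2P/imsetP => [[b c Ab Ac ->] | [[b c]]].
  by exists (b, c); rewrite ?inE ?Ab.
by rewrite inE => /andP[Ab Ac] ->; exists b c.
Qed.

Lemma leq_card_shift_energy (A : {set F}) (a : F) :
  (#|A| ^ 4 <= #|mul_shift_set a A| * shift_energy A a)%N.
Proof.
have := leq_card_collision (setX A A) (shift_prod a).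
by rewrite -mul_shift_setE cardsX mulnn -expnM.
Qed.

(** For distinct points, [b * (a + c) = b' * (a + c')] is affine in [a] with slope [b - b']. If the
    slope vanishes, cancelling [b != 0] gives [c = c'], a contradiction. Equal points agree for all
    [#|F|] values of [a]. *)
Lemma leq_sum_shift_eq (p p' : F * F) : p.1 != 0 ->
  (\sum_(a : F) (shift_prod a p == shift_prod a p') <= 1 + #|F| * (p == p'))%N.
Proof.
case: p p' => [b c] [b' c'] /= b0; have [_ | ne] := eqVneq (b, c) (b', c').
  rewrite muln1 addnC; apply: leq_trans (leq_addr 1 _).
  by rewrite -sum1_card leq_sum // => a _; case: eqP.
rewrite muln0 addn0.
have -> : (\sum_(a : F) (shift_prod a (b, c) == shift_prod a (b', c')) =
           #|[pred a | shift_prod a (b, c) == shift_prod a (b', c')]|)%N.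
  by rewrite -sum1_card [RHS]big_mkcond.
apply/card_le1_eqP => a2 a1; rewrite !inE /shift_prod /= => /eqP e2 /eqP e1.
have [eb | nb] := eqVneq b b'.
  move: e1 ne; rewrite -eb => /(mulfI b0) /addrI ->.
  by rewrite eqxx.
have nb0 : b - b' != 0 by rewrite subr_eq0.
apply: (mulfI nb0); apply/eqP; rewrite -subr_eq0; apply/eqP.
(* The difference of the two sides vanishes at both [a1] and [a2]; subtracting its two values
   eliminates [c] and [c']. *)
transitivity (b * (a1 + c) - b' * (a1 + c')
              - (b * (a2 + c) - b' * (a2 + c'))).
  by ring.
by rewrite e1 e2 !subrr.
Qed.

Lemma sum_shift_energy (A : {set F}) : 0 \notin A ->
  (\sum_(a : F) shift_energy A a <= #|A| ^ 4 + #|F| * #|A| ^ 2)%N.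
Proof.
move=> A0; rewrite /shift_energy exchange_big.
have -> : (#|A| ^ 4 + #|F| * #|A| ^ 2 =
   \sum_(p in setX A A) \sum_(p' in setX A A) (1 + #|F| * (p == p')))%N.
  have cE : (#|A| ^ 2 = #|setX A A|)%N by rewrite cardsX mulnn.
  rewrite (expnM _ 2 2) cE -mulnn -mulnDl mulnC -sum_nat_const.
  apply: eq_bigr => p Pp; rewrite big_split sum1_card /=; congr (_ + _)%N.
  rewrite -big_distrr (bigD1 p) //= eqxx big1 ?muln1 // => p' /andP[_].
  by rewrite eq_sym => /negPf ->.
apply: leq_sum => -[b c]; rewrite inE => /andP[/= Ab _].
rewrite exchange_big; apply: leq_sum => p' _; apply: leq_sum_shift_eq.
by apply: contraNneq A0 => /= <-.
Qed.

Lemma ex_large_mul_shift_set (A : {set F}) :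
  0 \notin A -> (#|F| ^ 2 < #|A| ^ 3)%N ->
  exists2 a : F, a \in A & (#|F| < 2 * #|mul_shift_set a A|)%N.
Proof.
move=> A0 ltA; apply/exists_inP; apply: contraLR ltA.
rewrite negb_exists_in => /forall_inP small; rewrite -leqNgt.
have [->|An0] := posnP #|A|; first by rewrite exp0n.
(* The indicator merges the bound valid for every [a] with the doubled one for failing [a] in [A],
   ready to be summed over the field. *)
have low a : (#|A| ^ 4 + (a \in A) * #|A| ^ 4 <= #|F| * shift_energy A a)%N.
  have cs := leq_card_shift_energy A a.
  have [/small | _] := boolP (a \in A).
    rewrite -leqNgt mul1n addnn -mul2n => Sa.
    apply: leq_trans (leq_mul Sa (leqnn _)).
    by rewrite -mulnA leq_pmul2l.
  by rewrite addn0 (leq_trans cs) // leq_mul2r max_card orbT.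
have : (\sum_(a : F) (#|A| ^ 4 + (a \in A) * #|A| ^ 4)
        <= #|F| * (#|A| ^ 4 + #|F| * #|A| ^ 2))%N.
  apply: leq_trans (_ : #|F| * \sum_(a : F) shift_energy A a <= _)%N.
    by rewrite big_distrr leq_sum.
  by rewrite leq_mul2l sum_shift_energy ?orbT.
(* The term [#|F| * #|A| ^ 4] cancels from both sides; dividing what remains by [#|A| ^ 2] needs [A]
   nonempty. *)
rewrite big_split sum_nat_const -big_distrl /= mulnDr leq_add2l.
rewrite -big_mkcond /= sum1_card -expnS mulnA mulnn.
by rewrite (expnD _ 3 2) leq_pmul2r // expn_gt0 An0.
Qed.

End ShiftedProduct.

Theorem theorem7 (R : realType) (F : finFieldType) (A : {set F}) :
  0 \notin A ->
  (#|F|%:R : R) `^ (2 / 3) < #|A|%:R ->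
  exists2 a : F, a \in A & (#|F|%:R : R) / 2 < #|mul_shift_set a A|%:R.
Proof.
move=> A0 ltA.
have [|a Aa lta] := ex_large_mul_shift_set A0; last first.
  by exists a => //; rewrite ltr_pdivrMr // mulrC -natrM ltr_nat.
(* Cubing clears the fractional exponent and leaves [#|F| ^ 2 < #|A| ^ 3] in the naturals. *)
have : ((#|F|%:R : R) `^ (2 / 3)) ^+ 3 < #|A|%:R ^+ 3.
  by rewrite ltrXn2r // powR_ge0.
rewrite -powR_mulrn ?powR_ge0 // -powRrM divfK ?pnatr_eq0 //.
by rewrite powR_mulrn ?ler0n // -!natrX ltr_nat.
Qed.
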